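(* Let $k \geq 3$ be an integer. For every $k$-regular graph $G$ (that is, every vertex of $G$ has degree exactly $k$), $V(G)$ can be partitioned into $k+1$ pairwise disjoint $k$-clique isolating sets of $G$.
   Context: All graphs are simple, finite and undirected. For $D \subseteq V(G)$, the closed neighborhood $N[D]$ is the set consisting of $D$ together with all vertices having a neighbor in $D$. A subset $D \subseteq V(G)$ is a $k$-clique isolating set of $G$ if $G - N[D]$ contains no complete graph $K_k$ as a subgraph. Partitions are weak, i.e. parts may be empty; equivalently, there is a map $c: V(G) \to \{1,\ldots,k+1\}$ (not required to be surjective) such that each of the $k+1$ color classes is a $k$-clique isolating set of $G$. *)

(* Defs.v *)
(* A finite simple undirected graph is a symmetric irreflexive
   relation [e] on a finType [T]. *)
From mathcomp Require Import all_boot.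

Set Implicit Arguments.
Unset Strict Implicit.
Unset Printing Implicit Defensive.

Definition neighborhood (T : finType) (e : rel T) (x : T) : {set T} :=
  [set y | e x y].

Definition closed_neighborhood (T : finType) (e : rel T) (D : {set T}) :
    {set T} :=
  D :|: [set x | [exists y in D, e x y]].

Definition regular_graph (T : finType) (e : rel T) (k : nat) : Prop :=
  forall x : T, #|neighborhood e x| = k.

(* [K] is the vertex set of a copy of the complete graph on k vertices. *)
Definition kclique (T : finType) (e : rel T) (k : nat) (K : {set T}) : Prop :=
  #|K| = k /\ {in K &, forall x y : T, x != y -> e x y}.

(* [K \subset ~: N[D]] says that the clique lives in the graph G - N[D]. *)
Definition kclique_isolating (T : finType) (e : rel T) (k : nat)
    (D : {set T}) : Prop :=
  ~ exists K : {set T}, K \subset ~: closed_neighborhood e D /\ kclique e k K.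

(* Parts are allowed to be empty, unlike in [finset.partition], so a partition
   into n parts is an indexed family. *)
Definition weak_partition (T : finType) (n : nat) (V : 'I_n -> {set T}) :
    Prop :=
  \bigcup_(i < n) V i = [set: T] /\
  forall i j : 'I_n, i != j -> [disjoint V i & V j].

(* Main.v *)
(* A color misses the N[K] of some k-clique K exactly when its class is not
   isolating, so it suffices to make every N[K] see all k+1 colors.  By
   k-regularity, two k-cliques sharing a vertex v lie in N[v], hence share at
   least k-1 vertices.  Take a maximal disjoint family P of k-cliques and attach
   to each A in P an outside neighbor u A, with two neighbors in A if possible.
   Then every k-clique K meets some A in P, and A together with u A lies in N[K].
   It remains to color so that each set A + u A of k+1 vertices is rainbow.
   A member of P containing no attached vertex can be colored last; if there is
   none, each member contains exactly one attached vertex, the members form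
   directed cycles, and three colors suffice for the attached vertices. *)
Require Import Defs.
From mathcomp Require Import all_boot.
From mathcomp Require Import zify.

Set Implicit Arguments.
Unset Strict Implicit.
Unset Printing Implicit Defensive.

(** * Colorings of disjoint sets with attached vertices *)

Section RainbowColoring.

Lemma color_avoiding (n : nat) (F : {set 'I_n}) :
  #|F| < n -> exists i, i \notin F.
Proof.
move=> ltFn; have : 0 < #|~: F| by rewrite cardsCs setCK card_ord subn_gt0.
by case/card_gt0P=> i; rewrite inE; exists i.
Qed.

Lemma injective_coloring_avoiding (T : finType) (n : nat) (A : {set T})
    (F : {set 'I_n.+1}) :
  #|A| + #|F| <= n.+1 ->
  exists c : T -> 'I_n.+1,
    {in A &, injective c} /\ {in A, forall x, c x \notin F}.
Proof.
move=> leAF.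
have szA : size (enum A) <= size (enum (~: F)).
  by rewrite -!cardE (cardsCs (~: F)) setCK card_ord; lia.
have idx x : x \in A -> index x (enum A) < size (enum (~: F)).
  by move=> xA; apply: leq_trans szA; rewrite index_mem mem_enum.
exists (fun x => nth ord0 (enum (~: F)) (index x (enum A))); split.
  move=> x y xA yA /eqP; rewrite nth_uniq ?idx ?enum_uniq // => /eqP eqi.
  by rewrite -[x](nth_index x (s := enum A)) ?mem_enum // eqi nth_index ?mem_enum.
move=> x xA; have := mem_nth ord0 (idx x xA).
by rewrite mem_enum inE.
Qed.

(** In the graph joining [x] to [g x], each point has at most two neighbors: its image and its
    unique preimage. Greedy coloring by induction therefore needs three colors. [g] may leave [P],
    since the induction deletes points. *)
Lemma injective_map_coloring (X : finType) (n : nat) (P : {set X}) (g : X -> X) :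
  2 < n -> {in P &, injective g} -> {in P, forall x, g x != x} ->
  exists m : X -> 'I_n, {in P, forall x, g x \in P -> m x != m (g x)}.
Proof.
move=> n_gt2; move: {2}#|P| (erefl #|P|) => s.
elim: s P => [|s IHs] P cardP g_inj g_fix.
  exists (fun=> Ordinal (ltnW (ltnW n_gt2))) => x.
  by rewrite (cards0_eq cardP) inE.
have /card_gt0P[x xP] : 0 < #|P| by rewrite cardP.
have sPx : {subset P :\ x <= P} by move=> y /setD1P[].
have [|||m mP] := IHs (P :\ x).
- by have := cardsD1 x P; rewrite xP cardP => -[].
- by move=> y z /sPx yP /sPx zP; apply: g_inj.
- by move=> y yP; apply/g_fix/sPx.
(* [y] is the preimage of [x] in [P]. If there is none, the default [x] only forbids one irrelevant
   color. *)
pose y := odflt x [pick y in P | g y == x].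
have [i] : exists i, i \notin [set m (g x); m y].
  by apply: color_avoiding; rewrite cards2; lia.
rewrite !inE negb_or => /andP[i_gx i_y].
exists (fun z => if z == x then i else m z) => z zP gzP.
have [->|zx] := eqVneq z x; first by rewrite (negPf (g_fix x xP)).
have [gzx|gzx] := eqVneq (g z) x.
  suff -> : z = y by rewrite eq_sym.
  rewrite /y; case: pickP => [w /andP[wP /eqP gwx]|/(_ z)] /=.
    by apply: g_inj => //; rewrite gzx.
  by rewrite zP gzx eqxx.
by apply: mP; rewrite !inE ?zx ?gzx.
Qed.

Lemma rainbow_coloring (T : finType) (k : nat) (P : {set {set T}})
    (u : {set T} -> T) :
  1 < k -> trivIset P -> {in P, forall A : {set T}, #|A| = k} ->
  {in P, forall A : {set T}, u A \notin A} ->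
  exists c : T -> 'I_k.+1,
    {in P, forall A : {set T}, {in A &, injective c} /\
                               {in A, forall x, c x != c (u A)}}.
Proof.
move=> k_gt1; move: {2}#|P| (erefl #|P|) => s.
elim: s P => [|s IHs] P cardP trivP sizeP uP.
  by exists (fun=> ord0) => A; rewrite (cards0_eq cardP) inE.
have [/exists_inP[A AP /forall_inP Afree]|] :=
  boolP [exists A in P, forall B in P, u B \notin A].
  have sPA : {subset P :\ A <= P} by move=> B /setD1P[].
  have [||||c cP] := IHs (P :\ A).
  - by have := cardsD1 A P; rewrite AP cardP => -[].
  - by apply: trivIsetS trivP; apply: subD1set.
  - by move=> B /sPA; apply: sizeP.
  - by move=> B /sPA; apply: uP.
  have [|d [d_inj d_av]] :=
    @injective_coloring_avoiding T k A [set c (u A)].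
    by rewrite cards1 sizeP // addn1.
  (* No attached vertex lies in [A], so recoloring [A] changes the color of no [u B]. *)
  exists (fun x => if x \in A then d x else c x) => B BP.
  rewrite (negPf (Afree B BP)).
  have [->|BA] := eqVneq B A.
    split=> [x y xA yA|x xA]; rewrite ?xA ?yA; first exact: d_inj.
    by have := d_av x xA; rewrite inE.
  have BnA x : x \in B -> x \in A = false.
    move=> xB; apply/negP => xA; case/eqP: BA.
    by rewrite -(def_pblock trivP BP xB) (def_pblock trivP AP xA).
  have [|c_inj c_u] := cP B; first by rewrite !inE BA.
  by split=> [x y xB yB|x xB]; rewrite !BnA //; [apply: c_inj | apply: c_u].
rewrite negb_exists => /forallP Pfull.
(* Each member [A] now contains an attached vertex, that of [g A]. By disjointness [u (g A)]
   determines [A], so [g] permutes [P]. *)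
have /fin_all_exists[g gP] A : exists B, A \in P -> (B \in P) && (u B \in A).
  have := Pfull A; rewrite negb_and.
  have [AP /= | _ _] := boolP (A \in P); last by exists A.
  by case/forall_inPn=> B BP /negPn uBA; exists B; rewrite BP.
have gPP A : A \in P -> g A \in P by case/gP/andP.
have ugP A : A \in P -> u (g A) \in A by case/gP/andP.
have g_inj : {in P &, injective g}.
  move=> A B AP BP eqg.
  by rewrite -(def_pblock trivP AP (ugP A AP)) eqg (def_pblock trivP BP (ugP B BP)).
have g_fix : {in P, forall A, g A != A}.
  by move=> A AP; apply: contraNneq (uP A AP) => eqg; rewrite -{1}eqg ugP.
have g_surj : g @: P = P.
  apply/eqP; rewrite eqEcard card_in_imset // leqnn andbT.
  by apply/subsetP => _ /imsetP[A AP ->]; apply: gPP.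
(* [m A] is the color planned for [u A]. As [u (g A)] lies in [A], its color [m (g A)] must differ
   from [m A]. *)
have [m mP] := injective_map_coloring (n := k.+1) k_gt1 g_inj g_fix.
have /fin_all_exists[d dP] A : exists d : T -> 'I_k.+1, A \in P ->
    {in A :\ u (g A) &, injective d} /\
    {in A :\ u (g A), forall x, d x \notin [set m A; m (g A)]}.
  have [AP | _] := boolP (A \in P); last by exists (fun=> ord0).
  (* The other [k - 1] vertices of [A] must avoid these two colors, which leaves [k - 1] colors. *)
  have [|d dA] := @injective_coloring_avoiding T k (A :\ u (g A)) [set m A; m (g A)].
    have := cardsD1 (u (g A)) A; rewrite ugP // sizeP // cards2.
    by case: (_ != _) => /=; lia.
  by exists d.
pose c x := let A := pblock P x in if x == u (g A) then m (g A) else d A x.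
have cE A x : A \in P -> x \in A -> c x = if x == u (g A) then m (g A) else d A x.
  by move=> AP xA; rewrite /c (def_pblock trivP AP xA).
(* By surjectivity of [g], each [u A] lies in some member [B] with [g B = A], where it was given the
   color [m A]. *)
have cu A : A \in P -> c (u A) = m A.
  rewrite -{1}g_surj => /imsetP[B BP ->].
  by rewrite (cE B) ?ugP // eqxx.
exists c => A AP; have [d_inj d_av] := dP A AP.
have dN x : x \in A -> x != u (g A) -> d A x != m A /\ d A x != m (g A).
  move=> xA xu; have := d_av x; rewrite !inE xu xA negb_or => /(_ isT).
  by case/andP.
split=> [x y xA yA|x xA].
  rewrite !(cE A) //.
  have [->|xu] := eqVneq x (u (g A)); have [->|yu] := eqVneq y (u (g A)) => //.
  - by have [_ /negP] := dN y yA yu => + eqd; rewrite -eqd eqxx.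
  - by have [_ /negP] := dN x xA xu => + eqd; rewrite eqd eqxx.
  - by apply: d_inj; rewrite !inE ?xu ?yu.
rewrite cu // (cE A) //; have [_|xu] := eqVneq x (u (g A)).
  by rewrite eq_sym mP ?gPP.
by have [] := dN x xA xu.
Qed.

End RainbowColoring.

(** * Cliques in regular graphs *)

Definition kcliques (T : finType) (e : rel T) (k : nat) : {set {set T}} :=
  [set K : {set T} | (#|K| == k) &&
    [forall x in K, forall y in K, (x != y) ==> e x y]].

Lemma kcliquesP (T : finType) (e : rel T) (k : nat) (K : {set T}) :
  reflect (kclique e k K) (K \in kcliques e k).
Proof.
rewrite inE; apply: (iffP andP) => [[/eqP cardK /forall_inP Ke]|[cardK Ke]].
  split=> // x y xK yK.
  by move/forall_inP: (Ke x xK) => /(_ y yK)/implyP.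
split; first exact/eqP.
by apply/forall_inP => x xK; apply/forall_inP => y yK; apply/implyP/Ke.
Qed.

Lemma maximal_disjoint_subfamily (T : finType) (Q : {set {set T}}) :
  set0 \notin Q ->
  exists P : {set {set T}}, [/\ trivIset P, P \subset Q &
    {in Q, forall K : {set T}, exists2 A : {set T}, A \in P & ~~ [disjoint A & K]}].
Proof.
move=> Q0; pose p (P : {set {set T}}) := trivIset P && (P \subset Q).
have [P /maxsetP[/andP[trivP sPQ] maxP]] : {P | maxset p P}.
  apply: ex_maxset; exists set0; rewrite /p sub0set andbT.
  by apply/trivIsetP => A; rewrite inE.
exists P; split=> // K KQ; apply/exists_inP; apply: contraT.
rewrite negb_exists_in => /forall_inP Kdisj.
have dKP : {in P, forall A : {set T}, [disjoint K & A]}.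
  by move=> A AP; rewrite disjoint_sym; apply/negPn/Kdisj.
have P0 : set0 \notin P by apply: contraNN Q0; apply: (subsetP sPQ).
have [trivKP KP] := trivIsetU1 dKP trivP P0.
(* Maximality forces [K |: P] to equal [P], although [K] is not in [P]. *)
case/negP: KP; rewrite -(maxP (K |: P)) ?setU11 ?subsetUr //.
by rewrite /p trivKP subUset sub1set KQ sPQ.
Qed.

Section RegularGraph.

Variables (T : finType) (e : rel T) (k : nat).
Hypotheses (k_ge3 : 3 <= k) (e_sym : symmetric e) (e_irr : irreflexive e).
Hypothesis e_reg : regular_graph e k.

(** The union lies in the closed neighborhood of a common vertex, which has [k + 1] elements, so the
    intersection has at least [2k - (k + 1)]. *)
Lemma kclique_inter_card (K A : {set T}) :
  kclique e k K -> kclique e k A -> ~~ [disjoint A & K] -> k <= #|A :&: K|.+1.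
Proof.
move=> [cardK Ke] [cardA Ae] /pred0Pn[v /andP[/= vA vK]].
have : #|A :|: K| <= #|v |: neighborhood e v|.
  apply/subset_leq_card/subsetP => x; rewrite !inE.
  have [//|xv] := eqVneq x v; rewrite eq_sym in xv.
  by case/orP=> xS; [apply: Ae | apply: Ke].
rewrite cardsU1 e_reg inE e_irr cardsU cardA cardK /=.
have := subset_leq_card (subsetIl A K); lia.
Qed.

Lemma kclique_outside_neighbor (A : {set T}) :
  kclique e k A -> exists2 u, u \notin A & exists2 x, x \in A & e x u.
Proof.
move=> [cardA Ae].
have /card_gt0P[v vA] : 0 < #|A| by lia.
have : ~~ (neighborhood e v \subset A :\ v).
  apply/negP => /subset_leq_card; rewrite e_reg.
  by have := cardsD1 v A; rewrite vA cardA; lia.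
case/subsetPn=> u; rewrite !inE => evu.
have [eq_uv|_ /= uA] := eqVneq u v; first by rewrite eq_uv e_irr in evu.
by exists u => //; exists v.
Qed.

(** If [u] has two neighbors in [A], then [K] contains one of them, as it misses at most one vertex
    of [A]. If no outside vertex has two, then [K = A] and any outside neighbor works: a vertex of
    [K] outside [A] would be adjacent to all of [A :&: K], which has at least [k - 1 >= 2]
    elements. *)
Lemma kclique_anchor (A : {set T}) :
  kclique e k A -> exists2 u, u \notin A &
    forall K, kclique e k K -> ~~ [disjoint A & K] ->
      exists2 x, x \in K & (x == u) || e x u.
Proof.
move=> Ac; have [cardA Ae] := Ac.
have [/existsP[u /andP[uA /card_gt1P[x [y [xu yu xy]]]]]|no2] :=
  boolP [exists u, (u \notin A) && (1 < #|A :&: neighborhood e u|)].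
  move: xu yu; rewrite !inE => /andP[xA eux] /andP[yA euy].
  exists u => // K Kc meet; have := kclique_inter_card Kc Ac meet.
  have [xK|xK] := boolP (x \in K); first by exists x; rewrite // e_sym eux orbT.
  have [yK|yK] := boolP (y \in K); first by exists y; rewrite // e_sym euy orbT.
  have : #|[set x; y]| <= #|A :\: K|.
    by apply/subset_leq_card/subsetP => z /set2P[] ->; rewrite !inE ?xK ?yK.
  by rewrite cards2 xy; have := cardsID K A; rewrite cardA; lia.
have [u uA [x xA exu]] := kclique_outside_neighbor Ac.
exists u => // K Kc meet; have [cardK Ke] := Kc.
have [KA|/subsetPn[b bK bA]] := boolP (K \subset A).
  have eqKA : K = A by apply/eqP; rewrite eqEcard KA cardK cardA leqnn.
  by exists x; rewrite ?eqKA ?exu ?orbT.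
case/existsP: no2; exists b; rewrite bA /=.
apply: leq_trans (_ : 1 < #|A :&: K|) _.
  by have := kclique_inter_card Kc Ac meet; lia.
apply/subset_leq_card/subsetP => z; rewrite !inE => /andP[zA zK].
by rewrite zA Ke //; apply: contraNneq bA => ->.
Qed.

Lemma clique_rainbow_coloring :
  exists c : T -> 'I_k.+1, forall (K : {set T}) (i : 'I_k.+1), kclique e k K ->
    exists2 x, c x = i & exists2 y, y \in K & (y == x) || e y x.
Proof.
have Q0 : set0 \notin kcliques e k.
  by apply/negP => /kcliquesP[]; rewrite cards0; lia.
have [P [trivP /subsetP sPQ maxP]] := maximal_disjoint_subfamily Q0.
(* The choice of [u] needs a default value off [P]; an empty graph has no [k]-clique. *)
have [x0 _|T0] := pickP (@predT T); last first.
  exists (fun=> ord0) => K i [cardK _].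
  have /card_gt0P[x _] : 0 < #|K| by lia.
  by have := T0 x.
have /fin_all_exists[u uP] A : exists u, A \in P -> u \notin A /\
    forall K, kclique e k K -> ~~ [disjoint A & K] ->
      exists2 x, x \in K & (x == u) || e x u.
  have [AP|_] := boolP (A \in P); last by exists x0.
  by have [u uA uK] := kclique_anchor (kcliquesP _ _ _ (sPQ A AP)); exists u.
have sizeP : {in P, forall A : {set T}, #|A| = k}.
  by move=> A /sPQ/kcliquesP[].
have [||c cP] := @rainbow_coloring T k P u _ trivP sizeP.
- by lia.
- by move=> A /uP[].
exists c => K i Kc.
have [A AP meet] := maxP K (introT (kcliquesP _ _ _) Kc).
have [_ /(_ K Kc meet) uK] := uP A AP; have [c_inj c_u] := cP A AP.
(* [A] and [u A] carry [k + 1] distinct colors, hence all of them. *)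
have : i \in c (u A) |: c @: A.
  suff -> : c (u A) |: c @: A = setT by rewrite inE.
  apply/eqP; rewrite eqEcard subsetT cardsT card_ord cardsU1.
  rewrite card_in_imset // sizeP //.
  suff -> : c (u A) \notin c @: A by rewrite add1n leqnn.
  by apply/imsetP => -[x xA eqc]; have := c_u x xA; rewrite eqc eqxx.
case/setU1P=> [->|/imsetP[x xA ->]]; first by exists (u A).
(* A vertex common to [A] and [K] equals [x] or is adjacent to it, because [A] is a clique. *)
exists x => //; case/pred0Pn: meet => v /andP[/= vA vK].
exists v => //; have [//|vx] := eqVneq v x.
by have /kcliquesP[_ ->] := sPQ A AP.
Qed.

End RegularGraph.

Theorem corollary1p10 (k : nat) (hk : 3 <= k) (T : finType) (e : rel T)
    (e_sym : symmetric e) (e_irr : irreflexive e) (e_reg : regular_graph e k) :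
  exists V : 'I_k.+1 -> {set T},
    weak_partition V /\ forall i : 'I_k.+1, kclique_isolating e k (V i).
Proof.
have [c cP] := clique_rainbow_coloring hk e_sym e_irr e_reg.
exists (fun i => [set x | c x == i]); split; first split.
- by apply/setP => x; rewrite inE; apply/bigcupP; exists (c x); rewrite ?inE.
- move=> i j ij; apply/pred0P => x /=; rewrite !inE.
  by apply/andP => -[/eqP -> /eqP eqij]; rewrite eqij eqxx in ij.
move=> i [K [/subsetP KN Kc]]; have [x cx [y yK yx]] := cP K i Kc.
have := KN y yK; rewrite !inE negb_or => /andP[cy /exists_inP[]].
case/orP: yx => [/eqP yx|eyx]; first by rewrite yx cx eqxx in cy.
by exists x; rewrite // inE cx.
Qed.
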